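(* Let $(X,d)$ be a Hausdorff left $K$-complete $T_0$-quasi-pseudometric space (Hausdorff meaning that $\tau(d)$ is Hausdorff). Let $\alpha : X\times X\to[0,\infty)$ and $\gamma\in\Gamma$, and suppose that $T:X\to X$ is an $(\alpha,\gamma)$-contractive mapping, i.e. $\alpha(x,y)\,d(Tx,Ty)\le\gamma(d(x,y))$ for all $x,y\in X$, which satisfies the following conditions: (i) $T$ is $\alpha$-admissible; (ii) there exists $x_0\in X$ such that $\alpha(x_0,Tx_0)\ge 1$; (iii) $T$ is $d$-sequentially continuous. Then $T$ has a fixed point, i.e. there is $x^*\in X$ with $Tx^*=x^*$.
   Context: A quasi-pseudometric on a nonempty set $X$ is a function $d:X\times X\to[0,\infty)$ with $d(x,x)=0$ and $d(x,z)\le d(x,y)+d(y,z)$ for all $x,y,z\in X$. It is a $T_0$-quasi-pseudometric if moreover $d(x,y)=0=d(y,x)$ implies $x=y$. The topology $\tau(d)$ has as base the balls $B_d(x,\varepsilon)=\{y\in X: d(x,y)<\varepsilon\}$, $x\in X$, $\varepsilon>0$. A sequence $(x_n)$ $d$-converges to $x$, written $x_n\xrightarrow{d}x$, if $d(x,x_n)\to0$. A sequence $(x_n)$ is left $K$-Cauchy if for every $\epsilon>0$ there is $n_0\in\mathbb{N}$ such that $d(x_k,x_n)<\epsilon$ whenever $n_0\le k\le n$. The space is left $K$-complete if every left $K$-Cauchy sequence is $d$-convergent. $T:X\to X$ is $d$-sequentially continuous if $x_n\xrightarrow{d}x$ implies $Tx_n\xrightarrow{d}Tx$. $T$ is $\alpha$-admissible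 if $\alpha(x,y)\ge1$ implies $\alpha(Tx,Ty)\ge1$ for all $x,y\in X$. $\Gamma$ is the set of functions $\gamma:[0,\infty)\to[0,\infty)$ that are nondecreasing and satisfy $\sum_{n=1}^\infty\gamma^n(t)<\infty$ for all $t>0$, where $\gamma^n$ is the $n$th iterate of $\gamma$. *)

(* Defs.v *)
From HB Require Import structures.
From mathcomp Require Import all_boot all_order all_algebra.
From mathcomp Require Import all_classical all_reals all_analysis.
Import Order.TTheory GRing.Theory Num.Theory.
Import numFieldNormedType.Exports.

Set Implicit Arguments.
Unset Strict Implicit.
Unset Printing Implicit Defensive.

Local Open Scope classical_set_scope.
Local Open Scope ring_scope.

Record quasi_pseudometric (R : realType) (X : Type) := QuasiPseudometric {
  qpm_dist :> X -> X -> R;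
  qpm_ge0 : forall x y, 0 <= qpm_dist x y;
  qpm_xx : forall x, qpm_dist x x = 0;
  qpm_triangle : forall x y z,
    qpm_dist x z <= qpm_dist x y + qpm_dist y z
}.

Section QuasiPseudometric.
Context {R : realType} {X : Type}.
Implicit Types (d : quasi_pseudometric R X) (u : nat -> X).

Definition T0_qpm d := forall x y, d x y = 0 -> d y x = 0 -> x = y.

Definition qpm_ball d (x : X) (e : R) : set X := [set y | d x y < e].

Definition qpm_balls d : set (set X) :=
  [set B | exists x e, 0 < e /\ B = qpm_ball d x e].

Definition qpm_cvg d u (x : X) := (fun n => d x (u n)) @ \oo --> (0 : R).

Definition left_K_cauchy d u := forall e : R, 0 < e ->
  exists n0 : nat, forall k n : nat, (n0 <= k <= n)%N -> d (u k) (u n) < e.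

Definition left_K_complete d := forall u, left_K_cauchy d u ->
  exists x, qpm_cvg d u x.

Definition seq_continuous d (T : X -> X) := forall u x,
  qpm_cvg d u x -> qpm_cvg d (T \o u) (T x).

Definition admissible (alpha : X -> X -> R) (T : X -> X) :=
  forall x y, 1 <= alpha x y -> 1 <= alpha (T x) (T y).

Definition contractive d (alpha : X -> X -> R) (gamma : R -> R) (T : X -> X) :=
  forall x y, alpha x y * d (T x) (T y) <= gamma (d x y).

Lemma qpm_balls_cover d : \bigcup_(B in qpm_balls d) B = setT.
Proof.
apply/seteqP; split=> // x _; exists (qpm_ball d x 1); first by exists x, 1.
by rewrite /qpm_ball /= qpm_xx ltr01.
Qed.

Lemma qpm_balls_join d (A B : set X) x : qpm_balls d A -> qpm_balls d B ->
  A x -> B x -> exists C, [/\ qpm_balls d C, C x & C `<=` A `&` B].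
Proof.
move=> [a [e [_ ->]]] [b [f [_ ->]]]; rewrite /qpm_ball /= => ax bx.
pose r := Num.min (e - d a x) (f - d b x).
have r0 : 0 < r by rewrite lt_min !subr_gt0 ax bx.
exists (qpm_ball d x r); split; first by exists x, r.
  by rewrite /qpm_ball /= qpm_xx.
move=> y; rewrite /qpm_ball /= lt_min !ltrBrDl => /andP[xye xyf].
by split; apply: le_lt_trans (qpm_triangle d _ x _) _.
Qed.

End QuasiPseudometric.

(* A copy of [X] indexed by [d], carrying the topology tau(d): its open sets
   are the unions of balls. *)
Definition qpm_space (R : realType) (X : Type)
  (d : quasi_pseudometric R X) : Type := X.

HB.instance Definition _ (R : realType) (X : Type)
  (d : quasi_pseudometric R X) := gen_eqMixin (qpm_space d).
HB.instance Definition _ (R : realType) (X : Type)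
  (d : quasi_pseudometric R X) := gen_choiceMixin (qpm_space d).
HB.instance Definition _ (R : realType) (X : Type)
  (d : quasi_pseudometric R X) :=
  @isBaseTopological.Build (qpm_space d) (set (qpm_space d))
    (qpm_balls d) id (qpm_balls_cover d) (@qpm_balls_join R X d).

(* The class Gamma: maps of [0, +oo[ into itself are represented by total
   functions on [R] constrained only on nonnegative arguments; the series of
   iterates starts at exponent 1. *)
Definition Gamma (R : realType) : set (R -> R) := [set gamma : R -> R |
  [/\ forall t : R, 0 <= t -> 0 <= gamma t,
      forall s t : R, 0 <= s -> s <= t -> gamma s <= gamma t &
      forall t : R, 0 < t ->
        cvgn (series (fun n => iter n.+1 gamma t) : R^nat)]].
Arguments Gamma R : clear implicits.

(* Main.v *)
(* Along the orbit [x_n = T^n x_0], admissibility and contractivity bound the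
   steps [d(x_n, x_(n+1))] by the summable terms [gamma^n(t)], so the orbit is
   left K-Cauchy. Its limit and the limit's image under [T] are both limits of
   the shifted orbit, hence coincide as tau(d) is Hausdorff. *)
Require Import Defs.
From mathcomp Require Import all_boot all_order all_algebra.
From mathcomp Require Import all_classical all_reals all_analysis.
From mathcomp Require Import lra.
Import Order.TTheory GRing.Theory Num.Theory.
Import numFieldNormedType.Exports.
Local Open Scope classical_set_scope.
Local Open Scope ring_scope.

(** The base gives a ball around [x] whose centre [y] may differ from [x]; the triangle inequality
    recentres it at [x], with radius [e - d y x]. *)
Lemma nbhs_qpm_ball (R : realType) (X : Type) (d : quasi_pseudometric R X)
    (x : qpm_space d) (A : set (qpm_space d)) :
  nbhs x A -> exists2 e : R, 0 < e & qpm_ball d x e `<=` A.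
Proof.
rewrite nbhsE => -[U [[D sD <-] [B DB Bx]] UA].
have [y [e [e_gt0 Be]]] := sD _ DB.
move: Bx; rewrite /= Be /qpm_ball /= => yx.
exists (e - d y x); first by rewrite subr_gt0.
move=> z xz; apply: UA; exists B => //=; rewrite Be /qpm_ball /=.
by apply: le_lt_trans (qpm_triangle d y x z) _; rewrite -ltrBrDl.
Qed.

(** Lets the Hausdorff property, which concerns neighbourhood filters, act on limits defined through
    [d]. *)
Lemma qpm_cvg_topology {R : realType} {X : Type} (d : quasi_pseudometric R X)
    (u : nat -> X) (x : X) :
  qpm_cvg d u x -> (u : nat -> qpm_space d) @ \oo --> (x : qpm_space d).
Proof.
move=> ux A Ax; have [e e_gt0 eA] := nbhs_qpm_ball _ _ _ _ _ Ax.
by apply: filterS (cvgr_lt 0 ux e e_gt0) => n; exact: eA.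
Qed.

Lemma qpm_cvg_unique {R : realType} {X : Type} (d : quasi_pseudometric R X) :
  hausdorff_space (qpm_space d) ->
  forall (u : nat -> X) (x y : X), qpm_cvg d u x -> qpm_cvg d u y -> x = y.
Proof.
move=> dH u x y ux uy.
exact: cvg_unique dH _ _ _ _ (qpm_cvg_topology d _ _ ux)
  (qpm_cvg_topology d _ _ uy).
Qed.

Lemma left_K_cauchy_summable {R : realType} {X : Type}
    (d : quasi_pseudometric R X) (u : nat -> X) (a : nat -> R) :
  (forall n, d (u n) (u n.+1) <= a n) ->
  cvgn (series (fun n => a n.+1) : R^nat) -> left_K_cauchy d u.
Proof.
set S := series _ => ua Scvg e e_gt0.
have a_ge0 n : 0 <= a n := le_trans (qpm_ge0 d _ _) (ua n).
(* Telescoping: [S n] is [a 1 + ... + a n], so the bound starts at [u 1], the step [a 0] being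
   outside the series. *)
have dS k n : d (u k.+1) (u (k + n).+1) <= S (k + n)%N - S k.
  elim: n => [|n IHn]; first by rewrite addn0 qpm_xx subrr.
  rewrite addnS; apply: le_trans (qpm_triangle d _ (u (k + n).+1) _) _.
  have -> : S (k + n).+1 = S (k + n)%N + a (k + n).+1 by rewrite /S seriesSr.
  by have := ua (k + n).+1; lra.
have Sle n : S n <= limn S.
  by apply: nondecreasing_cvgn_le => //; apply: nondecreasing_series.
have lt_lim : limn S - e < limn S by rewrite ltrBlDr ltrDl.
have [N _ NS] := cvgr_gt (limn S) Scvg _ lt_lim.
(* The threshold [N.+1] makes both indices successors, as [dS] requires; then [S] lies between
   [limn S - e] and [limn S] from [N] on. *)
exists N.+1 => -[|k] [|n] /andP[Nk kn] //.
rewrite -(subnKC kn) addSn; apply: le_lt_trans (dS k _) _.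
by have := NS k Nk; have := Sle (k + (n - k))%N; rewrite subSS /=; lra.
Qed.

Section ContractiveOrbit.
Context {R : realType} {X : Type} (d : quasi_pseudometric R X).
Context {alpha : X -> X -> R} {gamma : R -> R} {T : X -> X} {x0 : X}.
Hypothesis gammaP : Gamma R gamma.
Hypothesis T_contractive : contractive d alpha gamma T.
Hypothesis T_admissible : admissible alpha T.
Hypothesis T_start : 1 <= alpha x0 (T x0).

Lemma admissible_orbit n : 1 <= alpha (iter n T x0) (iter n.+1 T x0).
Proof. by elim: n => //= n; exact: T_admissible. Qed.

Lemma contractive_orbit (t : R) n : d x0 (T x0) <= t ->
  d (iter n T x0) (iter n.+1 T x0) <= iter n gamma t.
Proof.
case: gammaP => _ gamma_nd _ le_t; elim: n => //= n IHn.
apply: le_trans (gamma_nd _ _ (qpm_ge0 d _ _) IHn).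
apply: le_trans (T_contractive _ _).
(* Since [alpha] is at least 1 along the orbit, multiplying by it does not decrease the distance. *)
by rewrite ler_peMl ?qpm_ge0 //; exact: admissible_orbit.
Qed.

Lemma left_K_cauchy_orbit : left_K_cauchy d (fun n => iter n T x0).
Proof.
(* Summability is only known at [t > 0], while [d x0 (T x0)] may vanish. *)
pose t := d x0 (T x0) + 1.
apply: (@left_K_cauchy_summable _ _ _ _ (fun n => iter n gamma t)).
  by move=> n; apply: contractive_orbit; rewrite lerDl.
by case: gammaP => _ _; apply; rewrite ltr_wpDl ?qpm_ge0.
Qed.

End ContractiveOrbit.

Theorem theorem13 (R : realType) (X : Type) (X_neq0 : [set: X] !=set0)
    (d : quasi_pseudometric R X) (d_T0 : T0_qpm d)
    (d_hausdorff : hausdorff_space (qpm_space d))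
    (d_complete : left_K_complete d)
    (alpha : X -> X -> R) (alpha_ge0 : forall x y, 0 <= alpha x y)
    (gamma : R -> R) (gammaP : Gamma R gamma)
    (T : X -> X) (T_contractive : contractive d alpha gamma T)
    (T_admissible : admissible alpha T)
    (T_start : exists x0, 1 <= alpha x0 (T x0))
    (T_continuous : seq_continuous d T) :
  exists x, T x = x.
Proof.
have [x0 x0P] := T_start.
have orbit_cauchy :=
  left_K_cauchy_orbit d gammaP T_contractive T_admissible x0P.
have [x orbit_x] := d_complete _ orbit_cauchy.
exists x; apply: (qpm_cvg_unique d d_hausdorff) (T_continuous _ _ orbit_x) _.
(* The image of the orbit under [T] is the orbit shifted by one, so it also converges to [x]. *)
by rewrite /qpm_cvg -(cvg_shiftS (fun n => d x (iter n T x0))) in orbit_x.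
Qed.
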